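(* Let $R$ be a Dedekind domain with a countable number of maximal ideals. A torsion-free $R$-module $M$ is isomorphic to a direct sum of ideals of $R$ if it is the union of a countable ascending chain $$0 = M_0 \leq M_1 \leq \dots \leq M_n \leq \dots \quad (n<\omega)$$ of submodules, such that the following are satisfied for every $n<\omega$: (i) $M_n$ is isomorphic to a direct sum of ideals of $R$, and (ii) $M_n$ is pure in $M$.
   Context: A Dedekind domain is an integral domain all of whose ideals are projective. A submodule $N$ of an $R$-module $M$ is pure in $M$ if every finite system of equations $\sum_{j=1}^m r_{ij}x_j = a_i \in N$ ($i=1,\dots,n$), with $r_{ij}\in R$, is solvable in $N$ whenever it is solvable in $M$. Countable means finite or countably infinite. Direct sums of ideals are direct sums of (arbitrarily many) ideals of $R$ regarded as $R$-modules. *)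

(* Defs.v *)
From HB Require Import structures.
From mathcomp Require Import all_boot all_order all_algebra.
From mathcomp Require Import boolp classical_sets functions cardinality.

Set Implicit Arguments.
Unset Strict Implicit.
Unset Printing Implicit Defensive.

Import GRing.Theory.

Local Open Scope ring_scope.

(* A submodule of V is a [submodClosed V], a boolean predicate closed under the
   module operations; classically no submodule is lost ([asbool]).  [submodule S]
   is S regarded as an R-module in its own right. *)
Section SubmoduleType.
Variables (R : pzRingType) (V : lmodType R) (S : submodClosed V).

Definition submodule : Type := {x : V | x \in S}.

HB.instance Definition _ := SubChoice.on submodule.
HB.instance Definition _ := [SubChoice_isSubLmodule of submodule by <:].

End SubmoduleType.

(* R is commutative, so its ideals are the submodules of the regular module. *)
Notation ideal R := (submodClosed R^o).

Definition maximal_ideal (R : comNzRingType) (J : ideal R) : Prop :=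
  (exists x, x \notin J) /\
  forall K : ideal R,
    {subset J <= K} -> (exists x, x \notin K) -> {subset K <= J}.

Definition projective (R : pzRingType) (P : lmodType R) : Prop :=
  forall (A B : lmodType R) (g : {linear A -> B}) (f : {linear P -> B}),
    (forall b, exists a, g a = b) ->
    exists h : {linear P -> A}, forall x, g (h x) = f x.

Definition dedekind_domain (R : idomainType) : Prop :=
  forall J : ideal R, projective (submodule J).

Definition torsion_free (R : idomainType) (M : lmodType R) : Prop :=
  forall (r : R) (x : M), r *: x = 0 -> r = 0 \/ x = 0.

(* The i-th equation is \sum_j r i j *: x j = a i. *)
Definition pure (R : pzRingType) (M : lmodType R) (N : submodClosed M) : Prop :=
  forall (n m : nat) (r : 'M[R]_(n, m)) (a : 'I_n -> M),
    (forall i, a i \in N) ->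
    (exists x : 'I_m -> M, forall i, \sum_j r i j *: x j = a i) ->
    exists x : 'I_m -> M,
      (forall j, x j \in N) /\ forall i, \sum_j r i j *: x j = a i.

(* The external direct sum of a family of ideals J, as the R-module of the
   finitely supported families of elements of R with i-th component in J i. *)
Section DirectSum.
Variables (R : comNzRingType) (I : Type) (J : I -> ideal R).

Definition in_direct_sum : {pred I -> R^o} :=
  fun f => `[< (forall i, f i \in J i) /\ finite_set [set i | f i <> 0] >].

Fact in_direct_sum_closed : subsemimod_closed in_direct_sum.
Proof.
split; first split.
- apply/asboolP; split=> [i|]; first exact: rpred0.
  by apply: (@sub_finite_set _ _ set0) => // i /(_ erefl).
- move=> f g /asboolP[fJ ff] /asboolP[gJ fg]; apply/asboolP; split=> [i|].
    exact: rpredD (fJ i) (gJ i).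
  apply: (@sub_finite_set _ _ ([set i | f i <> 0] `|` [set i | g i <> 0])).
    move=> i /= h; apply: contrapT => /not_orP[/contrapT f0 /contrapT g0].
    by apply: h; change (f i + g i = 0); rewrite f0 g0 addr0.
  by rewrite finite_setU.
- move=> r f /asboolP[fJ ff]; apply/asboolP; split=> [i|].
    exact: rpredZ (fJ i).
  apply: sub_finite_set ff => i /= h f0.
  by apply: h; change (r *: f i = 0); rewrite f0 scaler0.
Qed.

HB.instance Definition _ :=
  GRing.isSubmodClosed.Build R (I -> R^o) in_direct_sum in_direct_sum_closed.

Definition direct_sum : lmodType R := submodule in_direct_sum.

End DirectSum.

Definition iso_direct_sum_of_ideals (R : comNzRingType) (M : lmodType R) : Prop :=
  exists (I : Type) (J : I -> ideal R) (f : {linear M -> direct_sum J}),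
    bijective f.

(* Main.v *)
(* Hill's argument.  Call a submodule A of M good if, for every n, A + N n is
   pure in M and A meets N n in the sum of a subset of the summands of a fixed
   decomposition of N n.  Countably many maximal ideals make the quotient field of
   R countably generated, so torsion-free modules of countable rank are countably
   generated; hence each good A and each x lie in a good A' with A'/A countably
   generated.  In A'/A, a finite-rank pure submodule sits in some (A + N n)/A, a
   direct sum of ideals, and so is separated by functionals into R; adjoining the
   generators of A' one at a time, each rank-one factor is then isomorphic to an
   ideal and splits off.  Zorn's lemma on the partial decompositions of M whose sum
   is good finishes the proof.

   A rank-one summand is represented by a nonzero element b, as the line of all x
   with r x = s b for some r <> 0. *)

From HB Require Import structures.
Require Import Defs.
From mathcomp Require Import all_boot all_order all_algebra.
From mathcomp Require Import boolp classical_sets functions cardinality fsbigop.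

Set Implicit Arguments.
Unset Strict Implicit.
Unset Printing Implicit Defensive.

Import GRing.Theory.

Local Open Scope classical_set_scope.
Local Open Scope ring_scope.

(** * Submodules and pure closures *)

Section Submodules.
Variables (R : pzRingType) (V : lmodType R).
Implicit Types (A B : set V).

Definition submod A : Prop :=
  A 0 /\ forall r x y, A x -> A y -> A (r *: x + y).

Lemma submod0 A : submod A -> A 0. Proof. by case. Qed.

Lemma submodZ A r x : submod A -> A x -> A (r *: x).
Proof. by move=> [A0 Al] Ax; rewrite -[_ *: _]addr0; exact: Al. Qed.

Lemma submodD A x y : submod A -> A x -> A y -> A (x + y).
Proof. by move=> [_ Al] Ax Ay; rewrite -[x]scale1r; exact: Al. Qed.

Lemma submodB A x y : submod A -> A x -> A y -> A (x - y).
Proof. by move=> [_ Al] Ax Ay; rewrite addrC -scaleN1r; exact: Al. Qed.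

Lemma submod_sum A (T : eqType) (s : seq T) (F : T -> V) :
  submod A -> (forall t, t \in s -> A (F t)) -> A (\sum_(t <- s) F t).
Proof.
move=> sA sF; rewrite big_seq; apply: big_ind => //; first exact: submod0.
by move=> x y; exact: submodD.
Qed.

Lemma submod_mem (S : submodClosed V) : submod [set x | x \in S].
Proof.
split=> [|r x y /= xS yS]; first exact: rpred0.
by apply: rpredD => //; exact: rpredZ.
Qed.

Definition sumset A B : set V := [set x | exists a b, [/\ A a, B b & x = a + b]].

Lemma sumset_submod A B : submod A -> submod B -> submod (sumset A B).
Proof.
move=> sA sB; split=> [|r _ _ [a [b [Aa Bb ->]]] [a' [b' [Aa' Bb' ->]]]].
  by exists 0, 0; rewrite addr0; split=> //; exact: submod0.
exists (r *: a + a'), (r *: b + b').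
by split; [case: sA => _; apply | case: sB => _; apply | rewrite scalerDr addrACA].
Qed.

Lemma sumsetl A B : submod B -> A `<=` sumset A B.
Proof. by move=> sB a Aa; exists a, 0; rewrite addr0; split=> //; exact: submod0. Qed.

Lemma sumsetr A B : submod A -> B `<=` sumset A B.
Proof. by move=> sA b Bb; exists 0, b; rewrite add0r; split=> //; exact: submod0. Qed.

Definition submod_pred A & submod A : {pred V} := fun x => `[< A x >].

Fact submod_pred_closed A (sA : submod A) : subsemimod_closed (submod_pred sA).
Proof.
split; first split.
- by apply/asboolP; exact: submod0.
- by move=> x y /asboolP Ax /asboolP Ay; apply/asboolP; exact: submodD.
- by move=> r x /asboolP Ax; apply/asboolP; exact: submodZ.
Qed.

HB.instance Definition _ A (sA : submod A) :=
  GRing.isSubmodClosed.Build R V (submod_pred sA) (submod_pred_closed sA).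

Lemma in_submod_pred A (sA : submod A) x : (x \in submod_pred sA) <-> A x.
Proof. by split=> /asboolP. Qed.

End Submodules.

Section PureClosure.
Variables (R : idomainType) (M : lmodType R).
Implicit Types (A B P W : set M).

(** For a submodule [P], torsion-freeness of [M/P]; in a torsion-free [M] it follows from purity. *)
Definition rdpure P : Prop := forall r x, r != 0 -> P (r *: x) -> P x.

(** For a submodule [P], the smallest submodule containing [P] and [g] with torsion-free quotient.
    One relation describes it, as the rank over [P] grows by at most one. *)
Definition pclosure P (g : M) : set M :=
  [set x | exists r s, r != 0 /\ P (r *: x - s *: g)].

Lemma pclosure_submod P g : submod P -> submod (pclosure P g).
Proof.
move=> sP; split=> [|c x y [r [s [r0 Px]]] [r' [s' [r'0 Py]]]].
  by exists 1, 0; rewrite oner_eq0 scaler0 scale0r subr0; split=> //; exact: submod0.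
exists (r * r'), (c * r' * s + r * s'); rewrite mulf_neq0//; split=> //.
have -> : (r * r') *: (c *: x + y) - (c * r' * s + r * s') *: g =
          (c * r') *: (r *: x - s *: g) + r *: (r' *: y - s' *: g).
  rewrite !scalerBr !scalerDr !scalerA scalerDl opprD addrACA.
  by congr (_ *: _ - _ + (_ - _)); rewrite mulrC [r * r']mulrC mulrA.
by apply: submodD => //; exact: submodZ.
Qed.

Lemma pclosure_sub P g : submod P -> P `<=` pclosure P g.
Proof.
by move=> sP x Px; exists 1, 0; rewrite oner_eq0 scale0r subr0 scale1r.
Qed.

Lemma pclosure_mem P g : submod P -> pclosure P g g.
Proof.
by move=> sP; exists 1, 1; rewrite oner_eq0 subrr; split=> //; exact: submod0.
Qed.

Lemma pclosure_rdpure P g : rdpure (pclosure P g).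
Proof.
move=> r x r0 [r' [s [r'0 Px]]]; exists (r' * r), s.
by rewrite mulf_neq0//; rewrite scalerA in Px.
Qed.

Lemma pclosure_subset P W g : submod W -> rdpure W -> P `<=` W -> W g ->
  pclosure P g `<=` W.
Proof.
move=> sW pW PW Wg x [r [s [r0 /PW Wx]]]; apply: (pW r) => //.
by rewrite -(subrK (s *: g) (r *: x)); apply: submodD => //; exact: submodZ.
Qed.

Lemma pclosure_mono P P' g : P `<=` P' -> pclosure P g `<=` pclosure P' g.
Proof. by move=> PP' x [r [s [r0 Px]]]; exists r, s; split=> //; exact: PP'. Qed.

Lemma pclosure_id P g : submod P -> rdpure P -> P g -> pclosure P g = P.
Proof.
move=> sP pP Pg; apply/seteqP; split; last exact: pclosure_sub.
exact: pclosure_subset.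
Qed.

Definition pclosures P (s : seq M) : set M := foldr (fun g Q => pclosure Q g) P s.

Lemma pclosures_submod P s : submod P -> submod (pclosures P s).
Proof. by move=> sP; elim: s => //= g s; exact: pclosure_submod. Qed.

Lemma pclosures_rdpure P s : rdpure P -> rdpure (pclosures P s).
Proof. by case: s => //= g s _; exact: pclosure_rdpure. Qed.

Lemma pclosures_sub P s : submod P -> P `<=` pclosures P s.
Proof.
move=> sP; elim: s => //= g s IH x Px.
by apply: pclosure_sub; [exact: pclosures_submod | exact: IH].
Qed.

Lemma pclosures_mono P P' s : P `<=` P' -> pclosures P s `<=` pclosures P' s.
Proof. by move=> PP'; elim: s => //= g s; exact: pclosure_mono. Qed.

(** * Spans over a base submodule *)

Inductive gspan A (T : Type) (X : T -> M) : set M :=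
| gspan_base x : A x -> gspan A X x
| gspan_step r t x : gspan A X x -> gspan A X (r *: X t + x).

Lemma gspan_submod A T (X : T -> M) : submod A -> submod (gspan A X).
Proof.
move=> sA; split=> [|r x y]; first by apply: gspan_base; exact: submod0.
elim=> {x} [x Ax|c t x _ IH] Ay.
  elim: Ay => {y} [y Ay|c t y _ IH].
    by apply: gspan_base; case: sA => _; apply.
  by rewrite addrCA; exact: gspan_step.
by rewrite scalerDr scalerA -addrA; apply: gspan_step; exact: IH.
Qed.

Lemma gspan_gen A T (X : T -> M) t : submod A -> gspan A X (X t).
Proof.
move=> sA; rewrite -[X t]addr0 -[X t]scale1r.
by apply: gspan_step; apply: gspan_base; exact: submod0.
Qed.

Lemma gspan_subset A T (X : T -> M) W : submod W -> A `<=` W ->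
  (forall t, W (X t)) -> gspan A X `<=` W.
Proof.
move=> sW AW XW x; elim=> {x} [x /AW //|r t x _ Wx].
by case: sW => _; apply.
Qed.

(** An element involves finitely many generators, so questions about a countably generated extension
    reduce to finitely many successive pure closures. *)
Lemma gspan_pclosures A T (X : T -> M) x : submod A -> gspan A X x ->
  exists ts : seq T, pclosures A (map X ts) x.
Proof.
move=> sA; elim=> {x} [x Ax|r t x _ [ts Px]]; first by exists [::].
exists (t :: ts) => /=; have sP := pclosures_submod (map X ts) sA.
have [_] := pclosure_submod (X t) sP; apply; first exact: pclosure_mem.
exact: pclosure_sub.
Qed.

(** * Functionals into [R] and separation *)

Definition functional_on W (phi : M -> R) : Prop :=
  forall r x y, W x -> W y -> phi (r *: x + y) = r * phi x + phi y.

(** Torsionlessness of [W/P], without forming the quotient: functionals are functions on all of [M],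
    linear on [W] only. *)
Definition separated P W : Prop :=
  forall w, W w -> ~ P w ->
  exists phi, [/\ functional_on W phi,
    (forall x, W x -> P x -> phi x = 0) & phi w != 0].

Lemma functional_on0 W phi : submod W -> functional_on W phi -> phi 0 = 0.
Proof.
move=> sW fW; have := fW 1 0 0 (submod0 sW) (submod0 sW).
rewrite scaler0 addr0 mul1r => /(congr1 (fun x => x - phi 0)).
by rewrite subrr addrK.
Qed.

Lemma functional_onZ W phi r x : submod W -> functional_on W phi -> W x ->
  phi (r *: x) = r * phi x.
Proof.
move=> sW fW Wx; rewrite -[_ *: _]addr0 fW//; last exact: submod0.
by rewrite (functional_on0 sW fW) addr0.
Qed.

Lemma functional_onD W phi x y : functional_on W phi -> W x -> W y ->
  phi (x + y) = phi x + phi y.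
Proof. by move=> fW Wx Wy; rewrite -[x in LHS]scale1r fW// mul1r. Qed.

Lemma functional_onB W phi x y : functional_on W phi -> W x -> W y ->
  phi (x - y) = phi x - phi y.
Proof. by move=> fW Wx Wy; rewrite addrC -scaleN1r fW// mulN1r addrC. Qed.

Lemma functional_on_sum W phi (T : eqType) (s : seq T) (F : T -> M) :
  submod W -> functional_on W phi -> (forall t, t \in s -> W (F t)) ->
  phi (\sum_(t <- s) F t) = \sum_(t <- s) phi (F t).
Proof.
move=> sW fW; elim: s => [|t s IH] sF; first by rewrite !big_nil (functional_on0 sW fW).
have sF' t' : t' \in s -> W (F t') by move=> ts; apply: sF; rewrite inE ts orbT.
rewrite !big_cons (functional_onD fW) ?IH//; first by apply: sF; rewrite mem_head.
exact: submod_sum.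
Qed.

(** Take [phi0] zero on [P] with [d = phi0 g] nonzero. The map [v -> d v - phi0(v) g] kills [g],
    preserves [P], and sends [w] outside [P], since otherwise [w] would lie in the closure. Compose
    it with a functional separating the image of [w]. *)
Lemma separated_pclosure P W g : submod W -> submod P -> rdpure P -> W g ->
  separated P W -> separated (pclosure P g) W.
Proof.
move=> sW sP pP Wg sep; have [Pg|nPg] := pselect (P g); first by rewrite pclosure_id.
have [phi0 [f0 k0 d0]] := sep _ Wg nPg; set d := phi0 g in d0.
move=> w Ww nw.
have nPw' : ~ P (d *: w - phi0 w *: g) by move=> Pw; apply: nw; exists d, (phi0 w).
have Wu v : W v -> W (d *: v - phi0 v *: g).
  by move=> Wv; apply: submodB => //; exact: submodZ.
have [psi [f1 k1 d1]] := sep _ (Wu _ Ww) nPw'.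
pose phi v := psi (d *: v - phi0 v *: g).
have fphi : functional_on W phi.
  move=> r x y Wx Wy; rewrite /phi (f0 r x y)// -(f1 r _ _ (Wu _ Wx) (Wu _ Wy)).
  congr (psi _).
  rewrite !scalerDr !scalerN !scalerDl !scalerA opprD addrACA.
  by congr (_ *: _ - _ + _); rewrite mulrC.
have phiP v : W v -> P v -> phi v = 0.
  move=> Wv Pv; rewrite /phi (k0 v)// scale0r subr0 k1//; exact: submodZ.
have phig : phi g = 0 by rewrite /phi subrr (functional_on0 sW f1).
exists phi; split=> // x Wx [r [s [r0 Px]]].
apply/eqP.
have := phiP _ _ Px; rewrite (functional_onB fphi) ?(functional_onZ _ sW fphi)//; last 2 first.
- exact: submodZ.
- exact: submodZ.
rewrite phig mulr0 subr0 => /(_ (submodB sW (submodZ _ sW Wx) (submodZ _ sW Wg))).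
by move=> /eqP; rewrite mulf_eq0 (negbTE r0).
Qed.

End PureClosure.
(** * Direct sums of lines *)

(* With [a] a fixed nonzero element of [J], the elements [p.1 / a] of the
   inverse of [J] and [p.2] of [J] have products that sum to 1. *)
Definition invertible (R : idomainType) (J : set R) : Prop :=
  forall a, J a -> a != 0 ->
  exists s : seq (R * R), \sum_(p <- s) p.1 * p.2 = a /\
    forall p, p \in s -> J p.2 /\ forall y, J y -> exists z, p.1 * y = z * a.

Section LineSums.
Variables (R : idomainType) (M : lmodType R).
Implicit Types (B : set M).
Hypothesis tfM : torsion_free M.

Lemma tf_eq0 (r : R) (x : M) : r != 0 -> r *: x = 0 -> x = 0.
Proof. by move=> r0 /tfM[] // /eqP; rewrite (negbTE r0). Qed.

Lemma tf_inj (r : R) (x y : M) : r != 0 -> r *: x = r *: y -> x = y.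
Proof.
move=> r0 /eqP; rewrite -subr_eq0 -scalerBr => /eqP /(tf_eq0 r0) /eqP.
by rewrite subr_eq0 => /eqP.
Qed.

Definition line (b : M) : set M := pclosure [set 0] b.

Lemma submod_set0 : submod [set (0 : M)].
Proof. by split=> //= r x y -> ->; rewrite scaler0 addr0. Qed.

Lemma line_submod b : submod (line b).
Proof. exact/pclosure_submod/submod_set0. Qed.

Lemma lineP b x : line b x <-> exists r s, r != 0 /\ r *: x = s *: b.
Proof.
by split=> -[r [s [r0 /eqP rx]]]; exists r, s; split=> //; apply/eqP;
  rewrite ?subr_eq0 // -subr_eq0.
Qed.

Inductive lsum B : set M :=
| lsum0 : lsum B 0
| lsum_add b x y : B b -> line b x -> lsum B y -> lsum B (x + y).

Lemma lsum_submod B : submod (lsum B).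
Proof.
split=> [|r x y]; first exact: lsum0.
elim=> {x} [|b x z Bb bx _ IH] By; first by rewrite scaler0 add0r.
rewrite scalerDr -addrA; apply: (lsum_add Bb); last exact: IH.
by apply: submodZ => //; exact: line_submod.
Qed.

Lemma lsum_line B b x : B b -> line b x -> lsum B x.
Proof. by move=> Bb bx; rewrite -[x]addr0; exact: lsum_add bx (lsum0 B). Qed.

Lemma lsum_mono B B' : B `<=` B' -> lsum B `<=` lsum B'.
Proof.
move=> BB' x; elim=> {x} [|b x y Bb bx _ IH]; first exact: lsum0.
by apply: lsum_add bx IH; exact: BB'.
Qed.

Lemma lsumU1 B c x : lsum (B `|` [set c]) x ->
  exists u v, [/\ lsum B u, line c v & x = u + v].
Proof.
elim=> {x} [|b x y [Bb|->] bx _ [u [v [Bu cv ->]]]].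
- by exists 0, 0; rewrite addr0; split=> //; [exact: lsum0 | apply: submod0; exact: line_submod].
- by exists (x + u), v; rewrite addrA; split=> //; exact: lsum_add bx Bu.
- exists u, (x + v); rewrite addrCA; split=> //.
  by apply: submodD => //; exact: line_submod.
Qed.

(** Multiplication by [q] carries the line into [R b]; for [b] nonzero in a torsion-free module the
    coefficient [s] identifies the line with an ideal. *)
Definition bounded_line b : Prop :=
  exists2 q, q != 0 & forall x, line b x -> exists s, q *: x = s *: b.

(* [dec B]: the sum of the lines through the elements of [B] is direct and
   each of these lines is isomorphic to an ideal. *)
Definition dec B : Prop :=
  (forall b, B b -> b <> 0 /\ bounded_line b) /\
  forall b x, B b -> line b x -> lsum (B `&` [set~ b]) x -> x = 0.

(* [Q] will be the complement of a point, as in the definition of [dec]. *)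
Lemma lsum_chain (F : set (set M)) (Q : set M) B0 x : total_on F subset -> F B0 ->
  lsum ((\bigcup_(B in F) B) `&` Q) x -> exists2 B, F B & lsum (B `&` Q) x.
Proof.
move=> tF FB0; elim=> {x} [|b x y [[B1 FB1 Bb] Qb] bx _ [B2 FB2 By]].
  by exists B0 => //; exact: lsum0.
have [B12|B21] := tF _ _ FB1 FB2.
  by exists B2 => //; apply: lsum_add bx By; split=> //; exact: B12.
exists B1 => //; apply: (lsum_add _ bx); first by [].
by apply: lsum_mono By => z [B2z Qz]; split=> //; exact: B21.
Qed.

Lemma dec_chain (F : set (set M)) : total_on F subset ->
  (forall B, F B -> dec B) -> dec (\bigcup_(B in F) B).
Proof.
move=> tF dF; split=> [b [B /dF[dB _] /dB //]|b x [B1 FB1 Bb] bx].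
move=> /(lsum_chain tF FB1)[B2 FB2 xB2].
have [B12|B21] := tF _ _ FB1 FB2.
  by apply: (dF _ FB2).2 bx xB2; exact: B12.
apply: (dF _ FB1).2 Bb bx _; apply: lsum_mono xB2 => z [Bz bz].
by split=> //; exact: B21.
Qed.

Lemma dec_add1 B c : dec B -> c <> 0 -> bounded_line c ->
  (forall x, lsum B x -> line c x -> x = 0) -> dec (B `|` [set c]).
Proof.
move=> [dB iB] c0 bc cB; split=> [b [/dB //|-> //]|b x [Bb|->] bx xB].
  have /lsumU1[u [v [Bu cv xuv]]] : lsum ((B `&` [set~ b]) `|` [set c]) x.
    by apply: lsum_mono xB => z [[Bz|->] zb]; [left | right].
  have v0 : v = 0.
    apply: cB => //; have -> : v = x - u by rewrite xuv addrC addKr.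
    apply: submodB; [exact: lsum_submod | exact: lsum_line bx|].
    by apply: lsum_mono Bu => z [].
  by apply: iB Bb bx _; rewrite xuv v0 addr0.
apply: cB => //; apply: lsum_mono xB => z [[//|->]] /=.
by case.
Qed.

Hypothesis invR : forall J : set R^o, submod J -> invertible J.

(* The image of [phi] on the pure closure of [lsum B] and [g] is an invertible
   ideal, so [phi] splits there; the image of the splitting is the new line. *)
Lemma dec_step B (W : set M) (phi : M -> R) (g : M) :
  dec B -> rdpure (lsum B) -> submod W -> pclosure (lsum B) g `<=` W ->
  functional_on W phi -> (forall x, lsum B x -> phi x = 0) -> phi g != 0 ->
  exists B', [/\ B `<=` B', dec B' & lsum B' = pclosure (lsum B) g].
Proof.
set P := lsum B; set Q := pclosure P g => dB pP sW QW fphi kphi g0.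
have sP : submod P by exact: lsum_submod.
have sQ : submod Q by exact: pclosure_submod.
have Qg : Q g by exact: pclosure_mem.
(* [Q/P] has rank one and [phi g] is nonzero, so [phi] is injective on [Q/P]. *)
have ker x : Q x -> phi x = 0 -> P x.
  move=> [r [s [r0 Px]]] x0; have Qx : Q x by exists r, s.
  have := kphi _ Px; rewrite (functional_onB fphi); last 2 first.
  - by apply: submodZ => //; exact: QW.
  - by apply: submodZ => //; exact: QW.
  rewrite !(functional_onZ _ sW fphi); [|exact: QW..].
  move=> /eqP; rewrite x0 mulr0 sub0r oppr_eq0 mulf_eq0 (negbTE g0) orbF => /eqP s0.
  by apply: (pP r) => //; rewrite s0 scale0r subr0 in Px.
pose J : set R^o := [set y | exists2 x, Q x & phi x = y].
have sJ : submod J.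
  split=> [|r _ _ [x Qx <-] [y Qy <-]].
    by exists 0; [exact: submod0 | exact: functional_on0 fphi].
  exists (r *: x + y); first by case: sQ => _; apply.
  by rewrite (fphi r x y)//; exact: QW.
have Jg : J (phi g) by exists g.
have [s [sa sJs]] := invR sJ Jg g0.
(* [w] is only a set-theoretic section of [phi] over [J]; invertibility turns it into the linear
   section [y -> \sum (p.1 y / phi g) w(p.2)]. *)
have [w wP] : exists w : R -> M, forall y, J y -> Q (w y) /\ phi (w y) = y.
  have /choice[w wP] : forall y : R, exists x, J y -> Q x /\ phi x = y.
    move=> y; have [[x Qx xy]|nJ] := pselect (J y); first by exists x.
    by exists 0.
  by exists w.
have Qw p : p \in s -> Q (w p.2) by move=> /sJs[/wP[]].
have phiw p : p \in s -> phi (w p.2) = p.2 by move=> /sJs[/wP[]].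
have phisum (z : R * R -> R) : phi (\sum_(p <- s) z p *: w p.2) = \sum_(p <- s) z p * p.2.
  rewrite (functional_on_sum sW fphi); last first.
    by move=> p ps; apply: QW; apply: submodZ => //; exact: Qw.
  apply: eq_big_seq => p ps; rewrite (functional_onZ _ sW fphi) ?phiw//.
  by apply: QW; exact: Qw.
(* The value of the linear section at [phi g]. *)
pose c := \sum_(p <- s) p.1 *: w p.2.
have Qc : Q c by apply: submod_sum => // p ps; apply: submodZ => //; exact: Qw.
have phic : phi c = phi g by rewrite phisum.
have phil x : line c x -> Q x /\ phi g *: x = phi x *: c.
  move=> /lineP[r [t [r0 rx]]].
  have Qx : Q x by apply: (@pclosure_rdpure _ _ P g r) => //; rewrite rx; exact: submodZ.
  split=> //; apply: (tf_inj r0).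
  rewrite scalerA (mulrC r) -(scalerA (phi g) r x) rx !scalerA; congr (_ *: _).
  rewrite -(functional_onZ _ sW fphi); last exact: QW.
  by rewrite rx (functional_onZ _ sW fphi) ?phic 1?mulrC//; exact: QW.
have cB x : lsum B x -> line c x -> x = 0.
  move=> Bx /phil[Qx]; rewrite (kphi x Bx) scale0r; exact: tf_eq0.
have c0 : c <> 0.
  move=> c0; move: g0; rewrite -phic c0 (functional_on0 sW fphi).
  by rewrite eqxx.
exists (B `|` [set c]); split; first by move=> x; left.
  apply: dec_add1 => //; exists (phi g) => // x /phil[_ ->].
  by exists (phi x).
apply/seteqP; split=> x.
  move=> /lsumU1[u [v [Bu /phil[Qv _] ->]]]; apply: submodD => //.
  exact: pclosure_sub.
move=> Qx.
have [z zP] : exists z : R * R -> R, forall p, p \in s -> p.1 * phi x = z p * phi g.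
  have /choice[z zP] : forall p, exists z, p \in s -> p.1 * phi x = z * phi g.
    move=> p; have [ps|nps] := boolP (p \in s); last by exists 0.
    have [z zp] := (sJs _ ps).2 (phi x) (ex_intro2 _ _ x Qx erefl).
    by exists z.
  by exists z.
(* The linear section at [phi x], with [z p = p.1 phi x / phi g]; then [x - x'] lies in the kernel
   [P]. *)
pose x' := \sum_(p <- s) z p *: w p.2.
have cx' : line c x'.
  apply/lineP; exists (phi g), (phi x); split=> //.
  rewrite !scaler_sumr; apply: eq_big_seq => p /zP zp.
  by rewrite !scalerA mulrC -zp mulrC.
have Qx' := (phil _ cx').1.
have x'x : phi x' = phi x.
  apply: (mulfI g0); rewrite phisum mulr_sumr [RHS]mulrC -[X in _ = _ * X]sa mulr_sumr.
  apply: eq_big_seq => p /zP zp.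
  by rewrite mulrA (mulrC (phi g)) -zp [RHS]mulrCA mulrA.
rewrite -(subrK x' x); apply: submodD; first exact: lsum_submod.
  apply: (@lsum_mono B); first by move=> y; left.
  apply: ker; first exact: submodB.
  by rewrite (functional_onB fphi) ?x'x ?subrr//; exact: QW.
by apply: lsum_line cx'; right.
Qed.

End LineSums.
(** * Countable generation *)

Lemma enum_countable T (A : set T) (t0 : T) : countable A ->
  exists e : nat -> T, forall x, A x -> exists k, e k = x.
Proof.
move=> /countable_injP[f fI].
have /choice[e eP] : forall k, exists x, (exists2 y, A y & f y = k) -> A x /\ f x = k.
  move=> k; have [[y Ay fy]|nk] := pselect (exists2 y, A y & f y = k); first by exists y.
  by exists t0.
exists e => x Ax; exists (f x).
have [Ae fe] := eP _ (ex_intro2 _ _ x Ax erefl).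
by apply: fI => //; exact/mem_set.
Qed.

Lemma enum_countType (S : Type) (s0 : S) (T : countType) (Y : T -> S) :
  exists Y' : nat -> S, forall t, exists k, Y' k = Y t.
Proof.
exists (fun k => if unpickle k is Some t then Y t else s0) => t.
by exists (pickle t); rewrite pickleK.
Qed.

(** Dual basis argument: [a = \sum p.1 p.2] gives [y = \sum (p.1 y / a) p.2], with coefficients in
    [R]. The empty list serves the zero ideal. *)
Lemma invertible_fg (R : idomainType) (J : set R) : invertible J ->
  exists s : seq (R * R), (forall p, p \in s -> J p.2) /\
    forall y, J y -> exists z : R * R -> R, y = \sum_(p <- s) z p * p.2.
Proof.
move=> iJ; have [[a Ja a0]|J0] := pselect (exists2 a, J a & a != 0); last first.
  exists [::]; split=> // y Jy; exists (fun=> 0); rewrite big_nil.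
  by apply/eqP; apply: contrapT => /negP y0; apply: J0; exists y.
have [s [sa sJ]] := iJ a Ja a0; exists s; split=> [p /sJ[]//|y Jy].
have /choice[z zP] : forall p, exists z, p \in s -> p.1 * y = z * a.
  move=> p; have [ps|nps] := boolP (p \in s); last by exists 0.
  by have [z zp] := (sJ _ ps).2 y Jy; exists z.
exists z; apply: (mulfI a0); rewrite -{1}sa mulr_suml mulr_sumr.
by apply: eq_big_seq => p /zP zp; rewrite mulrA (mulrC a) -zp mulrAC.
Qed.

Section Countability.
Variables (R : idomainType) (M : lmodType R).
Implicit Types (A P W : set M).
Hypothesis invR : forall J : set R^o, submod J -> invertible J.
Variable d : nat -> R.
Hypothesis d_neq0 : forall k, d k != 0.
Hypothesis d_dvd : forall r : R, r != 0 -> exists k t, d k = t * r.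

(** For fixed [k], the [s] with [d k y = s g] modulo [P] for some [y] form an ideal, which is
    finitely generated. Lifts of its generators suffice for this denominator, and every fraction has
    some [d k] as denominator. *)
Lemma pclosure_countable P g : submod P -> rdpure P ->
  exists Y : nat -> M, pclosure P g `<=` gspan P Y.
Proof.
move=> sP pP.
have /choice[ys ysP] : forall k, exists ys : seq M, forall y s,
    P (d k *: y - s *: g) -> gspan P (nth 0 ys) y.
  move=> k; pose J : set R^o := [set s | exists y, P (d k *: y - s *: g)].
  have sJ : submod J.
    split=> [|r s t [x Px] [y Py]].
      by exists 0; rewrite scaler0 scale0r subr0; exact: submod0.
    exists (r *: x + y).
    have -> : d k *: (r *: x + y) - (r *: s + t : R^o) *: g =
              r *: (d k *: x - s *: g) + (d k *: y - t *: g).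
      rewrite scalerBr scalerDr [(_ + t) *: g]scalerDl !scalerA opprD addrACA.
      by congr (_ *: _ - _ + _); rewrite mulrC.
    by case: sP => _; apply.
  have [s [sJs sgen]] := invertible_fg (invR sJ).
  have /choice[w wP] : forall p : R * R, exists y, p \in s -> P (d k *: y - p.2 *: g).
    move=> p; have [/sJs[y Py]|nps] := boolP (p \in s); first by exists y.
    by exists 0.
  exists (map w s) => y t Pt; have [|z tz] := sgen t; first by exists y.
  have sS : submod (gspan P (nth 0 (map w s))) by exact: gspan_submod.
  rewrite -(subrK (\sum_(p <- s) z p *: w p) y); apply: submodD => //.
    (* The combination subtracted has the same coefficient [t] at [g], so [d k] times the difference
       lies in [P], and purity cancels [d k]. *)
    apply: gspan_base; apply: (pP (d k)) => //.
    have -> : d k *: (y - \sum_(p <- s) z p *: w p) =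
        (d k *: y - t *: g) - \sum_(p <- s) z p *: (d k *: w p - p.2 *: g).
      rewrite scalerBr tz scaler_suml scaler_sumr -addrA -opprD -big_split/=.
      congr (_ - _); apply: eq_bigr => p _.
      by rewrite scalerBr !scalerA addrCA subrr addr0 mulrC.
    apply: submodB => //; apply: submod_sum => // p ps.
    by apply: submodZ => //; exact: wP.
  apply: submod_sum => // p ps; apply: submodZ => //.
  have -> : w p = nth 0 (map w s) (index p s) by rewrite (nth_map p) ?nth_index ?index_mem.
  exact: gspan_gen.
have [Y YP] := enum_countType 0 (fun ki : nat * nat => nth 0 (ys ki.1) ki.2).
exists Y => x [r [s [r0 Px]]]; have [k [t dk]] := d_dvd r0.
have /ysP : P (d k *: x - (t * s) *: g).
  by rewrite dk -!scalerA -scalerBr; exact: submodZ.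
apply: gspan_subset; first exact: gspan_submod.
  by move=> y Py; exact: gspan_base.
by move=> i; have [j <-] := YP (k, i); exact: gspan_gen.
Qed.

Lemma pclosures_countable P s : submod P -> rdpure P ->
  exists Y : nat -> M, pclosures P s `<=` gspan P Y.
Proof.
move=> sP pP; elim: s => [|g s [Y IH]] /=; first by exists (fun=> 0) => x; exact: gspan_base.
have sQ := pclosures_submod s sP; have pQ : rdpure (pclosures P s) by exact: pclosures_rdpure.
have [Y' Y'P] := pclosure_countable g sQ pQ.
have [Z ZP] := enum_countType 0
  (fun k : nat + nat => match k with inl i => Y i | inr i => Y' i end).
exists Z => x /Y'P; have sS : submod (gspan P Z) by exact: gspan_submod.
apply: gspan_subset => // [y /IH|i]; last by have [j <-] := ZP (inr i); exact: gspan_gen.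
apply: gspan_subset => // [z|i]; first exact: gspan_base.
by have [j <-] := ZP (inl i); exact: gspan_gen.
Qed.

End Countability.

(** * Coordinates and supports *)

Section Coordinates.
Variables (R : idomainType) (M : lmodType R).
Implicit Types (A P W N : set M) (L : set (M -> R)).
Hypothesis tfM : torsion_free M.

Definition axis N L (l : M -> R) : set M :=
  [set z | N z /\ forall l', L l' -> l' <> l -> l' z = 0].

(* [L] consists of the coordinate functions of a decomposition of [N]; the
   functions serve as their own indices, so a zero summand contributes at most
   the zero function. *)
Definition coords N L : Prop :=
  [/\ forall l, L l -> functional_on N l,
      forall x, N x -> (forall l, L l -> l x = 0) -> x = 0,
      forall x, N x -> exists s : seq {classic (M -> R)},
        forall l, L l -> l x != 0 -> (l : {classic _}) \in s &
      forall x l, N x -> L l -> exists2 y, axis N L l y & l y = l x].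

(** Subtracting one component of [x] at a time shortens a list bounding its support. *)
Lemma coords_axis N L A x : submod N -> coords N L -> submod A -> N x ->
  (forall l, L l -> l x != 0 -> axis N L l `<=` A) -> A x.
Proof.
move=> sN [fN iN sN' cN] sA Nx; have [s sx] := sN' x Nx.
elim: s x Nx sx => [|l s IH] x Nx sx xA.
  have -> : x = 0.
    apply: iN => // l Ll; apply/eqP; apply: contrapT => /negP lx.
    by have := sx l Ll lx.
  exact: submod0.
have [[Ll lx]|nl] := pselect (L l /\ l x != 0); last first.
  apply: IH => // l' Ll' l'x; have := sx _ Ll' l'x; rewrite inE => /orP[/eqP l'l|//].
  by case: nl; rewrite -l'l.
have [y [Ny yl] lyx] := cN x l Nx Ll.
rewrite -(subrK y x); apply: submodD => //; last by apply: (xA l).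
have e l' : L l' -> l' (x - y) = l' x - l' y.
  by move=> Ll'; rewrite (functional_onB (fN _ Ll')).
have e' l' : L l' -> l' (x - y) != 0 -> l' <> l /\ l' x != 0.
  move=> Ll'; rewrite e//; have [->|l'l] := pselect (l' = l).
    by rewrite lyx subrr eqxx.
  by rewrite (yl l')// subr0.
apply: IH; first exact: submodB.
- move=> l' Ll' /(e' _ Ll')[l'l l'x]; have := sx _ Ll' l'x.
  by rewrite inE => /orP[/eqP|].
- by move=> l' Ll' /(e' _ Ll')[_ l'x]; exact: xA.
Qed.

(** Expresses that an axis has rank at most one: every coordinate of the difference vanishes. *)
Lemma axis_prop N L l z w : submod N -> coords N L -> L l ->
  axis N L l z -> axis N L l w -> l w *: z = l z *: w.
Proof.
move=> sN [fN iN _ _] Ll [Nz zl] [Nw wl]; apply/eqP; rewrite -subr_eq0; apply/eqP.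
apply: iN => [|l' Ll']; first by apply: submodB => //; exact: submodZ.
have fl' := fN _ Ll'.
rewrite (functional_onB fl'); [|exact: submodZ..].
rewrite !(functional_onZ _ sN fl')//; have [->|l'l] := pselect (l' = l).
  by rewrite mulrC subrr.
by rewrite (zl l')// (wl l')// !mulr0 subrr.
Qed.

(** By [coords_axis], the intersection of [A] and [N] is then the sum of the axes it contains, with
    no set of axes to be named. *)
Definition axis_closed N L A : Prop := forall y l,
  A y -> N y -> L l -> l y != 0 -> axis N L l `<=` A.

(** Some coordinate [l] is nonzero on the [N]-part of [w] while its axis is not inside [A]. Then [l]
    vanishes on the intersection of [A] and [N], so it induces a functional on [(A + N)/A]. *)
Lemma axis_separated N L A : submod N -> coords N L -> submod A ->
  axis_closed N L A -> separated A (sumset A N).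
Proof.
move=> sN cN sA aA w [a [m [Aa Nm wE]]] nAw.
have nAm : ~ A m by move=> Am; apply: nAw; rewrite wE; exact: submodD.
have [l [Ll lm nl]] : exists l, [/\ L l, l m != 0 & ~ (axis N L l `<=` A)].
  apply: contrapT => nex; apply: nAm; apply: (coords_axis sN cN) => // l Ll lm.
  by apply: contrapT => nl; apply: nex; exists l.
have [fN _ _ _] := cN; have fl := fN _ Ll.
have l0 y : A y -> N y -> l y = 0.
  move=> Ay Ny; apply/eqP; apply: contrapT => /negP ly; apply: nl.
  exact: (aA y).
(* The choice [p] of an [N]-part need not be linear, but [l \o p] is: two choices differ by an
   element of both [A] and [N], where [l] vanishes. *)
have /choice[p pP] : forall v, exists p, sumset A N v -> N p /\ A (v - p).
  move=> v; have [[a' [m' [Aa' Nm' ->]]]|nv] := pselect (sumset A N v).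
    by exists m' => _; rewrite addrK.
  by exists 0.
have lp v m' : N m' -> A (v - m') -> sumset A N v -> l (p v) = l m'.
  move=> Nm' Avm /pP[Np Avp]; apply/eqP; rewrite -subr_eq0.
  rewrite -(functional_onB fl)//; apply/eqP; apply: l0; last exact: submodB.
  have -> : p v - m' = (v - m') - (v - p v) by rewrite opprB [RHS]addrC addrA subrK.
  exact: submodB.
have sW : submod (sumset A N) by exact: sumset_submod.
exists (l \o p); split=> /=.
- move=> r x y Wx Wy; have [Npx Apx] := pP x Wx; have [Npy Apy] := pP y Wy.
  rewrite /= (lp _ (r *: p x + p y)) ?(fl r)//.
  + by case: sN => _; apply.
  + by rewrite opprD addrACA -scalerBr; case: sA => _; apply.
  + by case: sW => _; apply.
- move=> x Wx Ax; rewrite (lp _ 0) ?(functional_on0 sN fl) ?subr0//; exact: submod0.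
- by rewrite (lp _ m)//; [rewrite wE addrK | exists a, m].
Qed.

(** Each element of [s] raises the rank by at most one, so a single [y0] in [N] accounts for the new
    supports, and its own support is finite. [Y] collects the components of these [y0]; an axis lies
    in the pure closure of any nonzero component on it. *)
Lemma support_countable N L A s : submod N -> coords N L -> submod A ->
  rdpure A -> axis_closed N L A ->
  exists Y : nat -> M, forall y l, N y -> pclosures A s y -> L l -> l y != 0 ->
    forall z, axis N L l z -> exists k, pclosure A (Y k) z.
Proof.
move=> sN cN sA pA aA; have [fN _ sN' cN'] := cN.
elim: s => [|x s [Y IH]] /=.
  exists (fun=> 0) => y l Ny Ay Ll ly z lz; exists 0%N.
  by apply: pclosure_sub => //; exact: (aA y l).
set P := pclosures A s in IH *.
have sP : submod P by exact: pclosures_submod.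
have pP : rdpure P by exact: pclosures_rdpure.
have [[y0 [Ny0 Py0 nPy0]]|nex] := pselect (exists y0, [/\ N y0, pclosure P x y0 & ~ P y0]);
    last first.
  exists Y => y l Ny Py; apply: IH => //.
  by apply: contrapT => nPy; apply: nex; exists y.
have [S SP] := sN' y0 Ny0.
have /choice[c cP] : forall l : M -> R, exists y, L l -> axis N L l y /\ l y = l y0.
  move=> l; have [Ll|nl] := pselect (L l); last by exists 0.
  by have [y ? ?] := cN' y0 l Ny0 Ll; exists y.
have [Z ZP] := enum_countType 0 (fun k : nat + nat =>
  match k with inl i => Y i | inr i => c (nth (fun=> 0) S i) end).
exists Z => y l Ny [r [t [r0 Py]]] Ll ly z lz; have fl := fN _ Ll.
have [ly0|ly0] := boolP (l y0 == 0); last first.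
  have lS := SP _ Ll ly0; have [j jE] := ZP (inr (index (l : {classic _}) S)).
  exists j; rewrite jE nth_index//; have [lc lcy0] := cP _ Ll.
  exists (l (c l)), (l z); rewrite lcy0 ly0; split=> //.
  by rewrite -lcy0 (axis_prop sN cN Ll lz lc) subrr; exact: submod0.
have [r' [t' [r'0 Py']]] := Py0.
have t'0 : t' != 0.
  apply/eqP => t'0; apply: nPy0; apply: (pP r') => //.
  by rewrite t'0 scale0r subr0 in Py'.
(* Eliminates [x] between the relations for [y] and [y0]; as [l y0 = 0], [l u] is a nonzero multiple
   of [l y]. *)
pose u := (t' * r) *: y - (t * r') *: y0.
have Nu : N u by apply: submodB => //; exact: submodZ.
have Pu : P u.
  have -> : u = t' *: (r *: y - t *: x) - t *: (r' *: y0 - t' *: x).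
    by rewrite !scalerBr !scalerA opprB addrA [t' * t]mulrC subrK.
  by apply: submodB => //; exact: submodZ.
have lu : l u != 0.
  rewrite /u (functional_onB fl); [|exact: submodZ..].
  rewrite !(functional_onZ _ sN fl)// (eqP ly0) mulr0 subr0.
  by rewrite !mulf_neq0.
have [k kz] := IH _ _ Nu Pu Ll lu z lz.
by have [j jE] := ZP (inl k); exists j; rewrite jE.
Qed.

End Coordinates.
(** * Good submodules *)

(* The closure of [x0] under countably many finitary operations is the image of
   a countable type of trees. *)
Fixpoint tree_eval (T : Type) (x0 : T) (f : seq T -> nat -> T)
    (t : GenTree.tree nat) : T :=
  match t with
  | GenTree.Leaf _ => x0
  | GenTree.Node c ts => f (map (tree_eval x0 f) ts) c
  end.

Section Filtration.
Variables (R : idomainType) (M : lmodType R).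
Implicit Types (A B : set M).
Hypothesis tfM : torsion_free M.
Hypothesis invR : forall J : set R^o, submod J -> invertible J.
Variable d : nat -> R.
Hypothesis d_neq0 : forall k, d k != 0.
Hypothesis d_dvd : forall r : R, r != 0 -> exists k t, d k = t * r.
Variables (N : nat -> set M) (L : nat -> set (M -> R)).
Hypothesis N_submod : forall n, submod (N n).
Hypothesis N_rdpure : forall n, rdpure (N n).
Hypothesis N_coords : forall n, coords (N n) (L n).
Hypothesis N0 : N 0%N `<=` [set 0].
Hypothesis N_mono : forall m n, (m <= n)%N -> N m `<=` N n.
Hypothesis N_cover : forall x, exists n, N n x.

(* The good submodules are those modulo which the chain [N] keeps its two
   properties: purity, and decomposability by a subset of the given summands. *)
Definition good A : Prop := forall n,
  rdpure (sumset A (N n)) /\ axis_closed (N n) (L n) A.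

Lemma good_rdpure A : good A -> rdpure A.
Proof.
move=> gA r x r0 Ax; have [pA _] := gA 0%N.
have [|a [b [Aa /N0 /= -> ->]]] := pA r x r0; first exact: sumsetl.
by rewrite addr0.
Qed.

(** A finite list of adjoined elements and an [n] call for countably many further elements; the
    countable type of trees iterates this until every such call is answered. *)
Lemma good_extend A x : submod A -> good A ->
  exists X : GenTree.tree nat -> M, good (gspan A X) /\ gspan A X x.
Proof.
move=> sA gA.
(* The first clause serves purity modulo [N n], the second the axes met by supports. *)
have /choice[cl clP] : forall sn : seq M * nat, exists Y : nat -> M,
    pclosures (sumset A (N sn.2)) sn.1 `<=` gspan (sumset A (N sn.2)) Y /\
    forall y l, N sn.2 y -> pclosures A sn.1 y -> L sn.2 l -> l y != 0 ->
      forall z, axis (N sn.2) (L sn.2) l z -> exists k, pclosure A (Y k) z.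
  move=> [s n] /=; have sW : submod (sumset A (N n)) by exact: sumset_submod.
  have [Y1 Y1P] := pclosures_countable invR d_neq0 d_dvd s sW (gA n).1.
  have [Y2 Y2P] := support_countable s (N_submod n) (N_coords n) sA
    (good_rdpure gA) (gA n).2.
  have [Y YP] := enum_countType 0
    (fun k : nat + nat => match k with inl i => Y1 i | inr i => Y2 i end).
  exists Y; split.
    move=> y /Y1P; apply: gspan_subset; first exact: gspan_submod.
      by move=> z; exact: gspan_base.
    by move=> i; have [j <-] := YP (inl i); exact: gspan_gen.
  move=> y l Ny Py Ll ly z lz; have [k kz] := Y2P y l Ny Py Ll ly z lz.
  by have [j jE] := YP (inr k); exists j; rewrite jE.
(* The label codes [(n, k)]: the node is the [k]-th element called for by its children and [n]. *)
pose f (s : seq M) (c : nat) : M :=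
  if unpickle c is Some nk then cl (s, nk.1) nk.2 else 0.
pose X := tree_eval x f; exists X.
have sS : submod (gspan A X) by exact: gspan_submod.
have XE ts n k : X (GenTree.Node (pickle (n, k)) ts) = cl (map X ts, n) k.
  by rewrite /X /= /f pickleK.
(* If [r y = a + m], finitely many generators produce [a], so [y] is in their pure closure over
   [A + N n], which is spanned over [A + N n] by further values of [X]. *)
have pS n : rdpure (sumset (gspan A X) (N n)).
  move=> r y r0 [a [m [Sa Nm ryE]]].
  have sW : submod (sumset A (N n)) by exact: sumset_submod.
  have [ts Pa] := gspan_pclosures sA Sa.
  have sP := pclosures_submod (map X ts) sW.
  have /(clP (map X ts, n)).1 : pclosures (sumset A (N n)) (map X ts) y.
    have pP : rdpure (pclosures (sumset A (N n)) (map X ts)).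
      by apply: pclosures_rdpure; exact: (gA n).1.
    apply: (pP r) => //; rewrite ryE; apply: submodD => //.
      apply: pclosures_mono Pa; exact: sumsetl.
    by apply: pclosures_sub => //; exact: sumsetr.
  apply: gspan_subset => /=.
  - exact: sumset_submod.
  - move=> _ [a' [m' [Aa' Nm' ->]]]; exists a', m'; split=> //; exact: gspan_base.
  - by move=> k; apply: sumsetl => //; rewrite -XE; exact: gspan_gen.
have pS0 : rdpure (gspan A X).
  move=> r y r0 Sy; have [|a [b [Sa /N0 /= -> ->]]] := pS 0%N r y r0.
    exact: sumsetl.
  by rewrite addr0.
split; last exact: (@gspan_gen _ _ A _ X (GenTree.Leaf 0%N)).
move=> n; split=> // y l Sy Ny Ll ly z lz.
have [ts Py] := gspan_pclosures sA Sy.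
have [k] := (clP (map X ts, n)).2 y l Ny Py Ll ly z lz.
apply: pclosure_subset => //=; first by move=> w; exact: gspan_base.
by rewrite -XE; exact: gspan_gen.
Qed.

(** Generators are adjoined singly, with pure closures. For large [n] each stage lies in [A + N n],
    where separation supplies the functional for [dec_step]; purity of the full span keeps every
    stage inside it. *)
Lemma dec_extend B (T : countType) (X : T -> M) :
  dec B -> good (lsum B) -> good (gspan (lsum B) X) ->
  exists B', [/\ B `<=` B', dec B' & lsum B' = gspan (lsum B) X].
Proof.
set A := lsum B => dB gA gS; have sA : submod A by exact: lsum_submod.
pose W n := sumset A (N n).
have sW n : submod (W n) by exact: sumset_submod.
have AW n : A `<=` W n by exact: sumsetl.
(* Separation is kept for all large [n], since the next generator may first appear in a larger
   [N n]. *)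
pose inv B1 := [/\ dec B1, rdpure (lsum B1) &
  exists n0, forall n, (n0 <= n)%N -> lsum B1 `<=` W n /\ separated (lsum B1) (W n)].
have step B1 g : inv B1 ->
    exists B2, [/\ B1 `<=` B2, inv B2 & lsum B2 = pclosure (lsum B1) g].
  move=> iB1; have [dB1 pB1 [n0 n0P]] := iB1.
  have sB1 : submod (lsum B1) by exact: lsum_submod.
  have [B1g|nB1g] := pselect (lsum B1 g).
    by exists B1; split=> //; rewrite pclosure_id.
  have [m Nmg] := N_cover g; pose n1 := maxn n0 m.
  have Wg n : (n1 <= n)%N -> W n g.
    rewrite geq_max => /andP[_ mn]; apply: sumsetr => //; exact: N_mono Nmg.
  have n1P n : (n1 <= n)%N -> lsum B1 `<=` W n /\ separated (lsum B1) (W n).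
    by rewrite geq_max => /andP[/n0P].
  have QW n : (n1 <= n)%N -> pclosure (lsum B1) g `<=` W n.
    move=> n1n; apply: pclosure_subset => //; [exact: (gA n).1|exact: (n1P _ n1n).1|].
    exact: Wg.
  have [phi [fphi kphi g0]] := (n1P _ (leqnn n1)).2 _ (Wg _ (leqnn n1)) nB1g.
  have [|B2 [B12 dB2 B2E]] := dec_step tfM invR dB1 pB1 (sW n1) (QW _ (leqnn n1)) fphi _ g0.
    by move=> x B1x; apply: kphi => //; exact: (n1P _ (leqnn n1)).1.
  exists B2; split=> //; split=> //; first by rewrite B2E; exact: pclosure_rdpure.
  exists n1 => n n1n; rewrite B2E; split; first exact: QW.
  by apply: separated_pclosure => //; [exact: Wg | exact: (n1P _ n1n).2].
have invB : inv B.
  split=> //; first exact: good_rdpure.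
  exists 0%N => n _; split; first exact: AW.
  by apply: axis_separated => //; exact: (gA n).2.
have /choice[nxt nxtP] : forall Bg : set M * M, exists B2, inv Bg.1 ->
    [/\ Bg.1 `<=` B2, inv B2 & lsum B2 = pclosure (lsum Bg.1) Bg.2].
  move=> [B1 g] /=; have [iB1|niB1] := pselect (inv B1); last by exists B1.
  by have [B2 B2P] := step B1 g iB1; exists B2.
(* Numbers coding no index adjoin 0, which leaves the sum unchanged. *)
pose g k := if unpickle k is Some t then X t else 0.
pose Bk := fix Bk k := if k is k'.+1 then nxt (Bk k', g k') else B.
have invk k : inv (Bk k) by elim: k => //= k /(nxtP (Bk k, g k))[].
have Bk_step k := nxtP (Bk k, g k) (invk k).
have Bk_mono k k' : (k <= k')%N -> Bk k `<=` Bk k'.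
  move=> /subnK <-; elim: (k' - k)%N => // i IH x /IH Bx.
  by have [/(_ x Bx)] := Bk_step (i + k)%N.
pose F := range Bk.
have tF : total_on F subset.
  move=> _ _ [k _ <-] [k' _ <-].
  by have [kk'|/ltnW k'k] := leqP k k'; [left|right]; exact: Bk_mono.
have FB : F B by exists 0%N.
have sumB k : lsum (Bk k) `<=` gspan A X.
  elim: k => [|k IH] x; first exact: gspan_base.
  have [_ _ ->] := Bk_step k; apply: pclosure_subset => //.
  - exact: gspan_submod.
  - exact: good_rdpure.
  - rewrite /g; case: unpickle => [t|]; first exact: gspan_gen.
    by apply: submod0; exact: gspan_submod.
exists (\bigcup_(B1 in F) B1); split.
- by move=> x Bx; exists B.
- by apply: dec_chain => // _ [k _ <-]; case: (invk k).
apply/seteqP; split=> x.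
  rewrite -[X in lsum X]setIT => /(lsum_chain tF FB)[_ [k _ <-]].
  by rewrite setIT; exact: sumB.
apply: gspan_subset; first exact: lsum_submod.
  by apply: lsum_mono => b Bb; exists B.
move=> t; apply: (@lsum_mono _ _ (Bk (pickle t).+1)).
  by move=> b Bb; exists (Bk (pickle t).+1) => //; exists (pickle t).+1.
have [_ _ ->] := Bk_step (pickle t); rewrite /= /g pickleK.
by apply: pclosure_mem; exact: lsum_submod.
Qed.

(** Each instance of goodness starts from one element, found in the sum of one member of the chain.
    For the empty chain the sum is zero and purity of [N n] is what remains. *)
Lemma good_lsum_chain (F : set (set M)) : total_on F subset ->
  (forall B, F B -> good (lsum B)) -> good (lsum (\bigcup_(B in F) B)).
Proof.
move=> tF gF; have [[B0 FB0]|F0] := pselect (exists B, F B); last first.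
  have -> : \bigcup_(B in F) B = set0.
    by apply/seteqP; split=> // x [B FB]; case: F0; exists B.
  have l0 : lsum (set0 : set M) `<=` [set 0] by move=> x; elim.
  move=> n; split.
    move=> r x r0 [_ [b [/l0 -> Nb]]]; rewrite add0r => rx.
    apply: sumsetr; first exact: lsum_submod.
    by apply: (N_rdpure r0); rewrite rx.
  move=> y l /l0 -> _ Ll; have [fN _ _ _] := N_coords n.
  by rewrite (functional_on0 (N_submod n) (fN _ Ll)) eqxx.
have chain x : lsum (\bigcup_(B in F) B) x -> exists2 B, F B & lsum B x.
  rewrite -[X in lsum X]setIT => /(lsum_chain tF FB0)[B FB].
  by rewrite setIT => Bx; exists B.
have sub B : F B -> lsum B `<=` lsum (\bigcup_(B in F) B).
  by move=> FB; apply: lsum_mono => x Bx; exists B.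
move=> n; split.
  move=> r x r0 [a [b [/chain[B FB Ba] Nb rx]]].
  have [|a' [b' [Ba' Nb' ->]]] := (gF _ FB n).1 r x r0; first by exists a, b.
  by exists a', b'; split=> //; exact: sub Ba'.
move=> y l /chain[B FB By] Ny Ll ly z lz; apply: (sub B FB).
exact: (gF _ FB n).2 By Ny Ll ly z lz.
Qed.

Lemma dec_exists : exists2 B, dec B & forall x : M, lsum B x.
Proof.
pose P := [set B | dec B /\ good (lsum B)].
have [F FP tF|B [[dB gB] Bmax]] := @Zorn_bigcup M P.
  split; first by apply: dec_chain => // B /FP[].
  by apply: good_lsum_chain => // B /FP[].
exists B => // x; apply: contrapT => nBx.
have [X [gX Xx]] := good_extend x (lsum_submod B) gB.
have [B' [BB' dB' B'E]] := dec_extend dB gB gX.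
apply: (Bmax B'); last by split=> //; rewrite B'E.
split=> // B'B; apply: nBx; rewrite -B'E in Xx; exact: lsum_mono Xx.
Qed.

End Filtration.
(** * Dedekind domains *)

Section DirectSumCoef.
Variables (R : comNzRingType) (I : Type) (J : I -> ideal R).

Definition direct_sum_coef (h : direct_sum J) (i : I) : R := val h i.

Lemma direct_sum_coef_lin r (g h : direct_sum J) i :
  direct_sum_coef (r *: g + h) i = r * direct_sum_coef g i + direct_sum_coef h i.
Proof. by []. Qed.

Lemma direct_sum_coefZ r (h : direct_sum J) i :
  direct_sum_coef (r *: h) i = r * direct_sum_coef h i.
Proof. by []. Qed.

Lemma direct_sum_coefP (h : direct_sum J) :
  (forall i, (direct_sum_coef h i : R^o) \in J i) /\
  finite_set [set i | direct_sum_coef h i <> 0].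
Proof. by have /asboolP := valP h. Qed.

Lemma direct_sum_ext (g h : direct_sum J) :
  (forall i, direct_sum_coef g i = direct_sum_coef h i) -> g = h.
Proof. by move=> gh; apply/val_inj/funext. Qed.

Lemma direct_sum_build (f : I -> R^o) : (forall i, f i \in J i) ->
  finite_set [set i | f i <> 0] -> exists h, direct_sum_coef h = f.
Proof.
move=> fJ ff; have fP : f \in in_direct_sum J by apply/asboolP.
by exists (exist _ f fP).
Qed.

End DirectSumCoef.

Section FreeCover.
Variables (R : comNzRingType) (V : lmodType R).

Lemma submod_setT : submod [set: R^o]. Proof. by split. Qed.

(** The free module on the underlying set of [V], every summand being the unit ideal; a cover that
    splits when [V] is projective. *)
Definition free_on : lmodType R :=
  direct_sum (fun _ : V => submod_pred submod_setT : ideal R).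

Lemma free_on_supp (h : free_on) : exists s : seq V, forall i, direct_sum_coef h i != 0 -> i \in s.
Proof.
have /asboolP[_ /finite_seqP[s sE]] := valP h.
exists s => i /eqP hi; have : [set` s] i by rewrite -sE.
by [].
Qed.

Definition free_eval (h : free_on) : V := \sum_(i \in [set: V]) direct_sum_coef h i *: i.

Lemma free_evalE (h : free_on) (s : seq V) : (forall i, direct_sum_coef h i != 0 -> i \in s) ->
  free_eval h = \sum_(i <- undup s) direct_sum_coef h i *: i.
Proof.
move=> hs; rewrite /free_eval (fsbigE (undup s)) ?undup_uniq//.
  by apply: eq_bigl => i; rewrite in_setT.
move=> i _; rewrite mem_undup => nis.
have /eqP -> : direct_sum_coef h i == 0 by apply: contraNT nis => /hs.
by rewrite scale0r.
Qed.

Fact free_eval_linear : linear free_eval.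
Proof.
move=> r g h; have [s sg] := free_on_supp g; have [t th] := free_on_supp h.
have hs i : direct_sum_coef h i != 0 -> i \in s ++ t by move=> /th; rewrite mem_cat orbC => ->.
have gs i : direct_sum_coef g i != 0 -> i \in s ++ t by move=> /sg; rewrite mem_cat => ->.
rewrite !(@free_evalE _ (s ++ t))//; last first.
  move=> i; rewrite direct_sum_coef_lin; apply: contraNT => nis.
  have /eqP -> : direct_sum_coef h i == 0 by apply: contraNT nis => /hs.
  have /eqP -> : direct_sum_coef g i == 0 by apply: contraNT nis => /gs.
  by rewrite mulr0 addr0.
rewrite scaler_sumr -big_split/=; apply: eq_bigr => i _.
by rewrite direct_sum_coef_lin scalerDl scalerA.
Qed.

HB.instance Definition _ := GRing.isLinear.Build R free_on V _ free_eval free_eval_linear.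

Lemma free_eval_surj v : exists h, free_eval h = v.
Proof.
pose f i : R^o := if i == v then 1 else 0.
have fP : f \in in_direct_sum (fun _ : V => submod_pred submod_setT : ideal R).
  apply/asboolP; split=> [i|]; first by apply/asboolP.
  apply: (@sub_finite_set _ _ [set v]) => // i /=; rewrite /f.
  by case: eqP.
exists (exist _ f fP); rewrite (@free_evalE _ [:: v]) /=; last first.
  by move=> i; rewrite /direct_sum_coef /= /f inE; case: (i == v) => //; rewrite eqxx.
by rewrite big_seq1 /direct_sum_coef /= /f eqxx scale1r.
Qed.

End FreeCover.

(** A splitting [h] of the free cover of [J] is a dual basis: [a = \sum h(a)_i i], and linearity
    gives [h(a)_i y = h(y)_i a]. *)
Lemma dedekind_invertible (R : idomainType) : dedekind_domain R ->
  forall J : set R^o, submod J -> invertible J.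
Proof.
move=> ddR J sJ a Ja a0; pose T := submodule (submod_pred sJ : ideal R).
have [h hP] := ddR (submod_pred sJ) (free_on T) T (@free_eval R T) idfun
  (@free_eval_surj R T).
have mk y : J y -> exists y' : T, val y' = y.
  by move=> Jy; exists (exist _ y (asboolT Jy)).
have [a' a'E] := mk a Ja; have [s sP] := free_on_supp (h a').
exists [seq (direct_sum_coef (h a') i, val i : R) | i <- undup s]; split.
  rewrite big_map /=; have := etrans (esym (free_evalE sP)) (hP a').
  move=> /(congr1 (fun u : T => val u : R)).
  rewrite (big_morph (fun u : T => val u : R) (fun _ _ => erefl) erefl).
  by rewrite /= a'E.
move=> _ /mapP[i _ ->] /=; split; first by have /asboolP := valP i.
move=> y Jy; have [y' y'E] := mk y Jy; exists (direct_sum_coef (h y') i).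
have : y *: a' = a *: y'.
  by apply: val_inj; rewrite !linearZ/= a'E y'E; exact: mulrC.
move=> /(congr1 (fun u => direct_sum_coef (h u) i)); rewrite !linearZ !direct_sum_coefZ => e.
by rewrite mulrC e mulrC.
Qed.

(** * Maximal avoiding ideals and countably many denominators *)

Lemma ideal_avoiding (R : pzRingType) (V : lmodType R) (D I : set V) :
  submod I -> (forall x, I x -> ~ D x) ->
  exists K, [/\ submod K, I `<=` K, forall x, K x -> ~ D x &
    forall K', submod K' -> K `<=` K' -> (forall x, K' x -> ~ D x) -> K' `<=` K].
Proof.
move=> sI ID.
pose G X := [/\ submod X, I `<=` X & forall x, X x -> ~ D x].
pose P := [set X | X = set0 \/ G X].
have [F FP tF|K [PK Kmax]] := @Zorn_bigcup V P; last first.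
  have GK : G K.
    case: PK => // K0; case: (Kmax I); last by right; split.
    rewrite K0; split=> // I0; have := I0 0 (submod0 sI).
    by [].
  have [sK IK KD] := GK; exists K; split=> // K' sK' KK' K'D.
  apply: contrapT => nK; apply: (Kmax K'); first by split.
  by right; split=> //; exact: subset_trans KK'.
have [[X0 [FX0 GX0]]|nG] := pselect (exists X, F X /\ G X); last first.
  left; apply/seteqP; split=> // x [X FX Xx].
  have [X0|GX] := FP _ FX; first by rewrite X0 in Xx.
  by case: nG; exists X.
have [sX0 IX0 _] := GX0.
have FG X x : F X -> X x -> G X by move=> /FP[->|].
right; split.
- split=> [|r x y [X FX Xx] [Y FY Yy]]; first by exists X0 => //; exact: submod0.
  have [XY|YX] := tF _ _ FX FY.
    have [[_ lY] _ _] := FG Y y FY Yy; exists Y => //; apply: lY => //; exact: XY.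
  have [[_ lX] _ _] := FG X x FX Xx; exists X => //; apply: lX => //; exact: YX.
- by move=> x Ix; exists X0 => //; exact: IX0.
- by move=> x [X FX Xx]; have [_ _ XD] := FG X x FX Xx; exact: XD.
Qed.

(* An ideal [K] maximal among those avoiding the products of the [p k] satisfies
   [K = K P] for every maximal [P] containing it, which contradicts the
   invertibility of [K]. *)
Lemma countable_denominators (R : idomainType) :
  (forall J : set R^o, submod J -> invertible J) ->
  countable [set J : ideal R | maximal_ideal J] ->
  exists d : nat -> R, (forall k, d k != 0) /\
    forall r : R, r != 0 -> exists k t, d k = t * r.
Proof.
move=> invR /(enum_countable (submod_pred (submod_setT R) : ideal R))[e eP].
(* One nonzero element of each listed ideal, or 1 if the ideal is zero. *)
have /choice[p pP] : forall k, exists p : R, p != 0 /\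
    forall x : R, x != 0 -> x \in e k -> p \in e k.
  move=> k; have [[x x0 xe]|nex] := pselect (exists2 x : R, x != 0 & x \in e k).
    by exists x.
  exists 1; rewrite oner_eq0; split=> // x x0 xe.
  by case: nex; exists x.
pose d0 (s : seq nat) : R := \prod_(i <- s) p i.
have d00 s : d0 s != 0 by rewrite prodf_seq_neq0; apply/allP => i _; exact: (pP i).1.
suff dvd (r : R) : r != 0 -> exists s t, d0 s = t * r.
  exists (fun k => if unpickle k is Some s then d0 s else 1); split=> [k|r r0].
    by case: unpickle => [s|]; rewrite ?oner_eq0.
  have [s [t st]] := dvd r r0; exists (pickle s), t.
  by rewrite pickleK.
move=> r0; apply: contrapT => nr.
pose D : set R^o := range d0; pose I : set R^o := [set x : R | exists t, x = t * r].
have sI : submod I.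
  split=> [|c _ _ [t ->] [u ->]]; first by exists 0; rewrite mul0r.
  by exists (c * t + u); rewrite mulrDl -mulrA.
have [|K [sK IK KD Kmax]] := @ideal_avoiding _ _ D I sI.
  by move=> _ [t ->] [s _ st]; apply: nr; exists s, t.
have Kr : K r by apply: IK; exists 1; rewrite mul1r.
have K1 : ~ K 1 by move=> /KD; apply; exists [::] => //; rewrite /d0 big_nil.
have [|P [sP KP P1 Pmax]] := @ideal_avoiding _ _ [set (1 : R^o)] K sK.
  by move=> x Kx x1; apply: K1; rewrite -x1.
have nP1 : ~ P 1 by move=> /P1; apply.
have [k ek] : exists k, e k = submod_pred sP.
  apply: eP; split=> [|J PJ [x xJ] y yJ].
    by exists (1 : R); apply/negP => /in_submod_pred.
  apply/in_submod_pred; apply: (Pmax [set x | x \in J]) => //.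
  - exact: submod_mem.
  - by move=> z Pz; apply: PJ; exact/in_submod_pred.
  - move=> z zJ z1; move: xJ; rewrite -[x]mulr1 -[1]z1 => /negP; apply.
    exact: (rpredZ x).
have [q0 /(_ r r0)] := pP k; set q := p k in q0 *.
rewrite ek => /(_ (asboolT (KP _ Kr))) /asboolP Pq.
(* The colon ideal of [K] by [q] contains [K] and avoids [D], as a product of the [p i] times [q] is
   again one; by maximality it is [K]. *)
have Kq y : K (y * q : R) -> K y.
  apply: (Kmax [set y : R | K (y * q : R)]).
  - split=> [|c x z]; first by rewrite /= mul0r; exact: (submod0 sK).
    by rewrite /= mulrDl -mulrA => Kx Kz; case: sK => _; apply.
  - by move=> x Kx; rewrite /= mulrC; exact: (submodZ q sK Kx).
  - move=> x Kx [s _ sx]; apply: (KD _ Kx); exists (k :: s) => //.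
    by rewrite /d0 big_cons mulrC -sx.
have [s [sq sP']] := invR P sP q Pq q0.
have [u [ur uK]] := invR K sK r Kr r0.
pose rP : set R^o := [set x : R | exists2 m, P m & x = r * m].
have srP : submod rP.
  split=> [|c _ _ [x Px ->] [y Py ->]]; first by exists 0; rewrite ?mulr0//; exact: (submod0 sP).
  exists (c *: x + y); first exact: (sP.2 c x y).
  by rewrite mulrDr mulrCA.
(* Invertibility of [P] writes [j.2] as [\sum z i i.2] with [z i = i.1 j.2 / q]. Since [z i q] is in
   [K], so is [z i], hence [j.1 z i] is a multiple of [r]. Summing, [r] lies in [r P], which forces
   1 into [P]. *)
have [m Pm rm] : rP r.
  rewrite -{1}ur; apply: submod_sum => // j /uK[Kj jK].
  have /choice[z zP] : forall i : R * R, exists z, i \in s -> i.1 * j.2 = z * q.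
    move=> i; have [/sP'[_ /(_ _ (KP _ Kj))[z zE]]|nis] := boolP (i \in s); last by exists 0.
    by exists z.
  have -> : j.1 * j.2 = \sum_(i <- s) j.1 * z i * i.2.
    apply: (mulfI q0); rewrite -{1}sq mulr_suml mulr_sumr.
    apply: eq_big_seq => i /zP zE.
    have -> : i.1 * i.2 * (j.1 * j.2) = (i.1 * j.2) * (i.2 * j.1) by rewrite [j.1 * j.2]mulrC mulrACA.
    rewrite zE [z i * q]mulrC -[LHS]mulrA; congr (_ * _).
    by rewrite [LHS]mulrC [i.2 * _]mulrC mulrAC.
  apply: submod_sum => // i is_; have [Pi _] := sP' i is_.
  have [w wE] : exists w, j.1 * z i = w * r.
    apply: jK; apply: Kq; rewrite -(zP i is_).
    exact: (submodZ i.1 sK Kj).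
  exists (w * i.2); first exact: (submodZ w sP Pi).
  by rewrite wE [w * r]mulrC mulrA.
apply: nP1; have -> : 1 = m; last by [].
by apply: (mulfI r0); rewrite mulr1.
Qed.
(** * Internal and external direct sums *)

(** Coordinates are the isomorphism followed by projections, extended by 0 outside [S]. Indices
    share a function only if their ideals are zero. *)
Lemma iso_coords (R : idomainType) (M : lmodType R) (S : submodClosed M) :
  iso_direct_sum_of_ideals (submodule S) -> exists L, coords [set x | x \in S] L.
Proof.
move=> [I [J [f [g fK gK]]]].
pose lam (i : I) (x : M) : R :=
  if insub x is Some u then direct_sum_coef (f u) i else 0.
have lamE i (u : submodule S) : lam i (val u) = direct_sum_coef (f u) i.
  by rewrite /lam valK.
have lift x : x \in S -> exists u : submodule S, val u = x.
  by move=> xS; exists (exist _ x xS).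
exists (range lam); split.
- move=> _ [i _ <-] r _ _ /lift[u <-] /lift[v <-].
  have -> : r *: val u + val v = val (r *: u + v) by [].
  by rewrite !lamE linearP direct_sum_coef_lin.
- move=> _ /lift[u <-] lam0; have -> : u = 0; last by [].
  apply: (can_inj fK); apply: direct_sum_ext => i; rewrite -lamE lam0//.
  by rewrite linear0.
- move=> _ /lift[u <-]; have [_ /(@finite_seqP {classic I})[s sE]] := direct_sum_coefP (f u).
  exists (map (lam : {classic I} -> {classic (M -> R)}) s) => _ [i _ <-] ui.
  apply: map_f; have : [set` s] i by rewrite -sE /=; apply/eqP; rewrite -lamE.
  by [].
- move=> _ _ /lift[u <-] [i _ <-].
  pose h (j : I) : R^o := if pselect (j = i) then direct_sum_coef (f u) i else 0.
  have hi : h i = direct_sum_coef (f u) i by rewrite /h; case: pselect.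
  have hj j : j <> i -> h j = 0 by rewrite /h; case: pselect.
  have [|| v vE] := @direct_sum_build _ _ J h.
  + move=> j; have [->|ji] := pselect (j = i); last by rewrite hj// rpred0.
    by rewrite hi; exact: (direct_sum_coefP (f u)).1.
  + apply: (@sub_finite_set _ _ [set i]) => // j /= hj0.
    by apply: contrapT => /hj.
  exists (val (g v)); last by rewrite !lamE gK vE hi.
  split; first exact: (valP (g v)).
  move=> _ [j _ <-] ji; rewrite lamE gK vE hj// => e.
  by apply: ji; rewrite e.
Qed.

(** * From lines inside [M] to an external direct sum of ideals *)

Section DecIso.
Variables (R : idomainType) (M : lmodType R) (B : set M).
Hypothesis tfM : torsion_free M.
Hypothesis dB : dec B.
Hypothesis BT : forall x, lsum B x.

Lemma lsum_split b x : B b -> exists2 y, line b y & lsum (B `&` [set~ b]) (x - y).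
Proof.
move=> Bb; have : lsum ((B `&` [set~ b]) `|` [set b]) x.
  apply: lsum_mono (BT x) => c Bc; have [->|cb] := pselect (c = b); first by right.
  by left.
by move=> /lsumU1[u [v [Bu bv ->]]]; exists v => //; rewrite addrK.
Qed.

Lemma lsum_finite x : exists s : seq M, lsum (B `&` [set` s]) x.
Proof.
elim: (BT x) => {x} [|b x y Bb bx _ [s sy]]; first by exists [::]; exact: lsum0.
exists (b :: s); apply: (lsum_add _ bx); first by split=> //=; rewrite mem_head.
by apply: lsum_mono sy => c [Bc sc]; split=> //=; rewrite inE sc orbT.
Qed.

Lemma dec_iso : iso_direct_sum_of_ideals M.
Proof.
have [bB iB] := dB.
have /choice[q qP] : forall b, exists q : R, B b ->
    q != 0 /\ forall x, line b x -> exists s, q *: x = s *: b.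
  move=> b; have [Bb|nBb] := pselect (B b); last by exists 0.
  by have [_ [q q0 qb]] := bB b Bb; exists q.
(* Graph of the coordinate at [b]: [y] is the component of [x] on the line. Directness and
   torsion-freeness make [s] unique. *)
pose C b x s := exists y, [/\ line b y, q b *: y = s *: b & lsum (B `&` [set~ b]) (x - y)].
have C_lin b r x x' s s' : C b x s -> C b x' s' -> C b (r *: x + x') (r * s + s').
  move=> [y [by_ yE xy]] [y' [by' yE' xy']]; exists (r *: y + y'); split.
  - by case: (line_submod b) => _; apply.
  - by rewrite scalerDr scalerA mulrC -scalerA yE yE' scalerDl scalerA.
  - rewrite opprD addrACA -scalerBr.
    by case: (lsum_submod (B `&` [set~ b])) => _; apply.
have C0 b s : B b -> C b 0 s -> s = 0.
  move=> Bb [y [by_ yE]]; rewrite sub0r => yB.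
  have y0 : y = 0.
    apply: (iB b) => //; rewrite -[y]opprK -scaleN1r; apply: submodZ => //.
    exact: lsum_submod.
  move: yE; rewrite y0 scaler0 => /esym /tfM[//|b0].
  by case: (bB b Bb).
have C_uniq b x s s' : B b -> C b x s -> C b x s' -> s = s'.
  move=> Bb Cs Cs'; have := C_lin b (-1) x x s s' Cs Cs'.
  rewrite scaleN1r addNr mulN1r => /(C0 _ _ Bb) /eqP.
  by rewrite addrC subr_eq0 => /eqP.
have /choice[co' coP'] : forall bx : M * M, exists s, B bx.1 -> C bx.1 bx.2 s.
  move=> [b x] /=; have [Bb|nBb] := pselect (B b); last by exists 0.
  have [y by_ xy] := lsum_split x Bb; have [s sE] := (qP b Bb).2 y by_.
  by exists s => _; exists y.
pose co b x := co' (b, x).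
have coP b x : B b -> C b x (co b x) by exact: (coP' (b, x)).
have coE b x s : B b -> C b x s -> co b x = s.
  by move=> Bb; apply: C_uniq => //; exact: coP.
have co_lin b r x y : B b -> co b (r *: x + y) = r * co b x + co b y.
  by move=> Bb; apply: coE => //; apply: C_lin; exact: coP.
have coD b x y : B b -> co b (x + y) = co b x + co b y.
  by move=> Bb; rewrite -[x in LHS]scale1r co_lin// mul1r.
have co_line b x : B b -> line b x -> q b *: x = co b x *: b.
  move=> Bb bx; have [s sE] := (qP b Bb).2 x bx; rewrite (coE b x s)//.
  by exists x; rewrite subrr; split=> //; exact: lsum0.
have co_other b c x : B b -> B c -> c <> b -> line b x -> co c x = 0.
  move=> Bb Bc cb bx; apply: coE => //; exists 0; rewrite scaler0 scale0r subr0.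
  split=> //; first by apply: submod0; exact: line_submod.
  by apply: lsum_line bx; split=> // /esym.
have co0 b : B b -> co b 0 = 0 by move=> Bb; apply: (C0 b) => //; exact: coP.
(* The values of the coordinate at [b]: the ideal isomorphic to its line. *)
pose Jset b : set R^o := [set s | exists2 x, line b x & q b *: x = s *: b].
have sJ b : submod (Jset b).
  split=> [|r s s' [x bx xE] [x' bx' xE']].
    by exists 0; [apply: submod0; exact: line_submod | rewrite scaler0 scale0r].
  exists (r *: x + x'); first by case: (line_submod b) => _; apply.
  by rewrite scalerDr scalerA mulrC -scalerA xE xE' [(_ + s') *: b]scalerDl scalerA.
have co_supp x : exists s : seq M, forall b, B b -> co b x != 0 -> b \in s.
  elim: (BT x) => {x} [|b x y Bb bx _ [s sP]].
    by exists [::] => b Bb; rewrite co0 ?eqxx.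
  exists (b :: s) => c Bc; rewrite inE; have [//|cb] := eqVneq c b.
  rewrite coD// (co_other b c x) ?add0r//; first exact: sP.
  exact/eqP.
(* Induction on a list of lines whose sum contains [x]: a zero coordinate discards the first
   line. *)
have co_inj x : (forall b, B b -> co b x = 0) -> x = 0.
  have [s] := lsum_finite x; elim: s x => [|b s IH] x sx x0.
    by move: sx; rewrite set_nil setI0; elim.
  have [Bb|nBb] := pselect (B b); last first.
    apply: IH => //; apply: lsum_mono sx => c [Bc /=].
    by rewrite inE => /orP[/eqP cb|//]; rewrite cb in Bc.
  have : lsum ((B `&` [set` s] `&` [set~ b]) `|` [set b]) x.
    apply: lsum_mono sx => c [Bc /=]; have [->|/eqP cb] := eqVneq c b; first by right.
    by rewrite inE => /orP[/eqP//|sc]; left.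
  move=> /lsumU1[u [v [Bu bv xE]]].
  have uB : lsum (B `&` [set~ b]) u by apply: lsum_mono Bu => c [[]].
  have cov : co b v = 0.
    rewrite -(x0 b Bb) xE; apply/esym/coE => //; exists v.
    by rewrite addrK; split=> //; exact: co_line.
  have v0 : v = 0.
    have := co_line b v Bb bv; rewrite cov scale0r.
    exact: (tf_eq0 tfM (qP b Bb).1).
  apply: IH => //; rewrite xE v0 addr0.
  by apply: lsum_mono Bu => c [].
have co_surj (s : seq M) (h : M -> R) : (forall b, B b -> Jset b (h b)) ->
    (forall b, B b -> h b != 0 -> b \in s) ->
    exists x, forall b, B b -> co b x = h b.
  elim: s h => [|b s IH] h hJ hs.
    exists 0 => b Bb; rewrite co0//; apply/esym/eqP; apply: contrapT => /negP h0.
    by have := hs b Bb h0.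
  pose h' c := if c == b then 0 else h c.
  have [|| x xP] := IH h'.
  - move=> c Bc; rewrite /h'; case: eqP => _; last exact: hJ.
    exact: (submod0 (sJ c)).
  - move=> c Bc; rewrite /h'; case: (eqVneq c b) => [_|cb]; first by rewrite eqxx.
    by move=> /(hs _ Bc); rewrite inE (negbTE cb).
  have [Bb|nBb] := pselect (B b); last first.
    exists x => c Bc; rewrite xP// /h'; case: eqP => // cb.
    by rewrite cb in Bc.
  have [y by_ yE] := hJ b Bb; exists (x + y) => c Bc; rewrite coD// xP// /h'.
  case: eqP => [->|cb]; last by rewrite (co_other b c y)// addr0.
  rewrite add0r; apply: coE => //; exists y.
  by rewrite subrr; split=> //; exact: lsum0.
pose I := {b : M | B b}; pose J (i : I) : ideal R := submod_pred (sJ (sval i)).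
have val_I_inj : injective (@sval M B).
  by move=> [b Bb] [c Bc] /= bc; subst c; congr exist; exact: Prop_irrelevance.
have /choice[F FP] : forall x, exists h : direct_sum J,
    direct_sum_coef h = fun i => co (sval i) x.
  move=> x; apply: direct_sum_build.
    move=> [b Bb]; apply/in_submod_pred => /=.
    by have [y [by_ yE _]] := coP b x Bb; exists y.
  have [s sP] := co_supp x.
  apply: (@sub_finite_set _ _ (sval @^-1` [set` s])).
    by move=> [b Bb] /= /eqP; exact: sP.
  by apply: finite_preimage => // i j _ _; exact: val_I_inj.
have FE x i : direct_sum_coef (F x) i = co (sval i) x by rewrite FP.
have Flin : linear F.
  move=> r x y; apply: direct_sum_ext => i; rewrite direct_sum_coef_lin !FE.
  by apply: co_lin; exact: (svalP i).
pose F' : {linear M -> direct_sum J} :=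
  HB.pack F (GRing.isLinear.Build R M (direct_sum J) _ F Flin).
have Fsurj h : exists x, F x = h.
  have [hJ /(@finite_seqP {classic I})[s sE]] := direct_sum_coefP h.
  pose h0 b := if pselect (B b) is left Bb then direct_sum_coef h (exist _ b Bb) else 0.
  have h0E i : h0 (sval i) = direct_sum_coef h i.
    rewrite /h0; case: pselect => [Bb|]; last by have := svalP i.
    by congr (direct_sum_coef _ _); exact: val_I_inj.
  have [|| x xP] := co_surj (map (sval : {classic I} -> M) s) h0.
  - move=> b Bb; rewrite (h0E (exist _ b Bb)); by have /asboolP := hJ (exist _ b Bb).
  - move=> b Bb; rewrite (h0E (exist _ b Bb)) => /eqP hb.
    have bs : [set` s] (exist _ b Bb : {classic I}) by rewrite -sE.
    exact: (map_f (sval : {classic I} -> M) bs).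
  exists x; apply: direct_sum_ext => i; rewrite FE xP ?h0E//; exact: (svalP i).
have /choice[G GP] := Fsurj.
exists I, J, F', G => //= x.
apply/eqP; rewrite -subr_eq0; apply/eqP/co_inj => b Bb.
have := congr1 (fun h => direct_sum_coef h (exist _ b Bb)) (GP (F x)).
rewrite !FE /= => e.
by rewrite addrC -scaleN1r co_lin// e mulN1r addNr.
Qed.

End DecIso.

(** * From the pure chain to the decomposition of [M] *)

Lemma pure_rdpure (R : idomainType) (M : lmodType R) (S : submodClosed M) :
  torsion_free M -> pure S -> rdpure [set x | x \in S].
Proof.
move=> tfM pS r x r0 /= rxS.
(* One equation in one unknown; torsion-freeness makes its solution unique, so it is [x]. *)
have [|| y [yS yE]] := pS 1 1 (const_mx r) (fun=> r *: x).
- by [].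
- by exists (fun=> x) => i; rewrite big_ord1 mxE.
have := yE ord0; rewrite big_ord1 mxE => /(tf_inj tfM r0) <-.
exact: yS.
Qed.

Theorem corollary13 (R : idomainType) (M : lmodType R)
    (N : nat -> submodClosed M) :
  dedekind_domain R ->
  countable [set J : ideal R | maximal_ideal J]%classic ->
  torsion_free M ->
  (forall x : M, x \in N 0%N <-> x = 0) ->
  (forall n : nat, {subset N n <= N n.+1}) ->
  (forall x : M, exists n : nat, x \in N n) ->
  (forall n : nat, iso_direct_sum_of_ideals (submodule (N n))) ->
  (forall n : nat, pure (N n)) ->
  iso_direct_sum_of_ideals M.
Proof.
move=> ddR cR tfM N0 N_mono N_cover N_iso N_pure.
have invR := dedekind_invertible ddR.
have [d [d0 d_dvd]] := countable_denominators invR cR.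
have /choice[L LP] := fun n => iso_coords (N_iso n).
have [B dB BT] : exists2 B : set M, dec B & forall x, lsum B x.
  apply: (dec_exists tfM invR d0 d_dvd (N := fun n => [set x | x \in N n]) _ _ LP).
  - by move=> n; exact: submod_mem.
  - by move=> n; exact: pure_rdpure.
  - by move=> x /N0.
  - move=> m n /subnK <- x /= xm; elim: (n - m)%N => // k IH.
    exact: N_mono.
  - exact: N_cover.
exact: dec_iso tfM dB BT.
Qed.
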